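(* Let $\boldsymbol{s}\in\mathbb{R}^d$ be the supply vector and $\boldsymbol{D}\in\mathbb{R}^d$ the (realized) demand vector of the distribution network with distribution matrix $A$. Let $f_1,f_2:\mathbb{R}^d\to\mathbb{R}$ be differentiable and increasing functions. Suppose $\boldsymbol{x}^*=\begin{pmatrix}\boldsymbol{x}^{*+}\\ \boldsymbol{x}^{*-}\end{pmatrix}$ (with $\boldsymbol{x}^{*+},\boldsymbol{x}^{*-}\in\mathbb{R}^d$) is the optimal solution to the problem $$\min\ f_1(\boldsymbol{x}^{+})\quad\text{s.t.}\quad (A'-I)\boldsymbol{x}^{+}+I\boldsymbol{x}^{-}=\boldsymbol{s}-\boldsymbol{D},\qquad \boldsymbol{x}^{+}\ge\boldsymbol{0},\ \boldsymbol{x}^{-}\ge\boldsymbol{0}.$$ Then $\boldsymbol{x}^*$ is also the optimal solution to the problem $$\min\ f_2(\boldsymbol{x}^{+})\quad\text{s.t.}\quad (A'-I)\boldsymbol{x}^{+}+I\boldsymbol{x}^{-}=\boldsymbol{s}-\boldsymbol{D},\qquad \boldsymbol{x}^{+}\ge\boldsymbol{0},\ \boldsymbol{x}^{-}\ge\boldsymbol{0}.$$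
   Context: Network: $G=(V,E)$ is a directed graph with $V=\{1,\dots,d\}$ and incidence matrix $H$, where $H(i,j)=1$ if $(i,j)\in E$, $H(i,j)=0$ otherwise, and $H(i,i)=0$ for all $i$. The matrix $H$ is assumed irreducible. The matrix $A=(a_{ij})_{i,j\in V}$ satisfies $a_{ij}=0$ if $H(i,j)=0$, $a_{ij}>0$ if $H(i,j)=1$, and $\sum_{j=1}^d a_{ij}=1$ for every $i$ (so $a_{ii}=0$). Prime denotes transpose, $I$ is the $d\times d$ identity matrix, $\boldsymbol{0}$ is the zero vector in $\mathbb{R}^d$, and vector inequalities are componentwise. ''Increasing'' means strictly increasing in each coordinate: if $\boldsymbol{x}\le\boldsymbol{y}$ componentwise and $\boldsymbol{x}\ne\boldsymbol{y}$, then $f(\boldsymbol{x})<f(\boldsymbol{y})$. In the paper's model, $\boldsymbol{D}$ is a realization of a Gaussian random vector. *)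

(* Defs.v *)
From HB Require Import structures.
From mathcomp Require Import all_boot all_order all_algebra all_fingroup.
From mathcomp Require Import all_classical all_reals all_analysis.
Set Implicit Arguments.
Unset Strict Implicit.
Unset Printing Implicit Defensive.

Import Order.TTheory GRing.Theory Num.Theory.
Import numFieldNormedType.Exports.
Local Open Scope ring_scope.

Definition incidence_mx (R : realType) (d : nat) (E : rel 'I_d) : 'M[R]_d :=
  \matrix_(i, j) (E i j)%:R.

(* Some simultaneous permutation of rows and columns puts M in the form
   [[B, C], [0, F]] with B and F square of positive sizes k and d - k. *)
Definition reducible_mx (R : realType) (d : nat) (M : 'M[R]_d) : Prop :=
  exists (p : 'S_d) (k : nat), (0 < k < d)%N /\
    forall i j : 'I_d, (k <= i)%N -> (j < k)%N ->
      row_perm p (col_perm p M) i j = 0.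

Definition irreducible_mx (R : realType) (d : nat) (M : 'M[R]_d) : Prop :=
  ~ reducible_mx M.

Definition distribution_mx (R : realType) (d : nat) (H A : 'M[R]_d) : Prop :=
  [/\ forall i j, H i j = 0 -> A i j = 0,
      forall i j, H i j = 1 -> 0 < A i j
    & forall i, \sum_j A i j = 1].

Definition vec_le (R : realType) (d : nat) (x y : 'cV[R]_d) : Prop :=
  forall i, x i 0 <= y i 0.

Definition vec_increasing (R : realType) (d : nat) (f : 'cV[R]_d -> R) : Prop :=
  forall x y, vec_le x y -> x <> y -> f x < f y.

(* The decision vector stacks x^+ (upper half) on top of x^- (lower half). *)
Definition feasible (R : realType) (d : nat) (A : 'M[R]_d) (s D : 'cV[R]_d)
    (x : 'cV[R]_(d + d)) : Prop :=
  [/\ (A^T - 1%:M) *m usubmx x + 1%:M *m dsubmx x = s - D,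
      vec_le 0 (usubmx x)
    & vec_le 0 (dsubmx x)].

Definition optimal (R : realType) (d : nat) (f : 'cV[R]_d -> R)
    (A : 'M[R]_d) (s D : 'cV[R]_d) (x : 'cV[R]_(d + d)) : Prop :=
  feasible A s D x /\
  forall y, feasible A s D y -> f (usubmx x) <= f (usubmx y).

(* Main.v *)
(* The network equation makes x^- = (s - D) + (I - A') x^+, so feasibility is a
   condition on x^+ alone.  As A >= 0, that condition is stable under
   componentwise minima, and hence an optimal x^+ for any increasing objective
   is the least feasible x^+, which does not depend on the objective. *)
Require Import Defs.
From HB Require Import structures.
From mathcomp Require Import all_boot all_order all_algebra all_fingroup.
From mathcomp Require Import all_classical all_reals all_analysis.
Import Order.TTheory GRing.Theory Num.Theory.
Import numFieldNormedType.Exports.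
Local Open Scope ring_scope.

Set Implicit Arguments.
Unset Strict Implicit.

Lemma distribution_mx_ge0 (R : realType) (d : nat) (E : rel 'I_d)
    (A : 'M[R]_d) :
  distribution_mx (incidence_mx R E) A -> forall i j, 0 <= A i j.
Proof.
move=> [A0 A1 _] i j; case Eij: (E i j).
  by apply/ltW/A1; rewrite mxE Eij.
by rewrite A0 // mxE Eij.
Qed.

Lemma vec_increasing_le (R : realType) (d : nat) (f : 'cV[R]_d -> R) x y :
  vec_increasing f -> vec_le x y -> f x <= f y.
Proof.
move=> f_incr le_xy; have [->//|/eqP ne_xy] := eqVneq x y.
exact/ltW/f_incr.
Qed.

(** Strictness of the increase is what turns a comparison of objective values into an equality of
    vectors. *)
Lemma vec_increasing_le_eq (R : realType) (d : nat) (f : 'cV[R]_d -> R) x y :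
  vec_increasing f -> vec_le x y -> f y <= f x -> x = y.
Proof.
move=> f_incr le_xy le_fyx; apply/eqP/negPn/negP => /eqP ne_xy.
by have := f_incr _ _ le_xy ne_xy; rewrite ltNge le_fyx.
Qed.

(** The only lower half compatible with the upper half [u] in the network equation. *)
Definition slack (R : realType) (d : nat) (A : 'M[R]_d) (s D u : 'cV[R]_d) :
    'cV[R]_d :=
  s - D + (u - A^T *m u).

Lemma slackE (R : realType) (d : nat) (A : 'M[R]_d) (s D u : 'cV[R]_d) i :
  slack A s D u i 0 = (s - D) i 0 + (u i 0 - \sum_j A j i * u j 0).
Proof.
rewrite /slack !mxE; congr (_ + (_ - _)).
by apply: eq_bigr => j _; rewrite mxE.
Qed.

Lemma network_eqP (R : realType) (d : nat) (A : 'M[R]_d)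
    (s D u v : 'cV[R]_d) :
  (A^T - 1%:M) *m u + 1%:M *m v = s - D <-> v = slack A s D u.
Proof.
rewrite /slack mulmxBl !mul1mx -(opprB u); split=> [<-|->].
  by rewrite addrAC addNr add0r.
by rewrite addrC addrK.
Qed.

Lemma feasibleP (R : realType) (d : nat) (A : 'M[R]_d) (s D : 'cV[R]_d)
    (x : 'cV[R]_(d + d)) :
  feasible A s D x <->
  [/\ dsubmx x = slack A s D (usubmx x), vec_le 0 (usubmx x)
    & vec_le 0 (slack A s D (usubmx x))].
Proof.
split=> [[/network_eqP ex ux dx]|[ex ux dx]].
  by split; rewrite -?ex.
by split; [apply/network_eqP| |rewrite ex].
Qed.

Definition vec_min (R : realType) (d : nat) (u v : 'cV[R]_d) : 'cV[R]_d :=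
  \col_i Num.min (u i 0) (v i 0).

Lemma vec_min_le_l (R : realType) (d : nat) (u v : 'cV[R]_d) :
  vec_le (vec_min u v) u.
Proof. by move=> i; rewrite mxE ge_min lexx. Qed.

Lemma vec_min_le_r (R : realType) (d : nat) (u v : 'cV[R]_d) :
  vec_le (vec_min u v) v.
Proof. by move=> i; rewrite mxE ge_min lexx orbT. Qed.

(* Lowering [u] while keeping coordinate [i] fixed only decreases the inflow
   into [i]. *)
Lemma slack_le (R : realType) (d : nat) (A : 'M[R]_d) (s D u w : 'cV[R]_d) i :
    (forall i j, 0 <= A i j) -> vec_le w u -> w i 0 = u i 0 ->
  slack A s D u i 0 <= slack A s D w i 0.
Proof.
move=> A_ge0 le_wu wi; rewrite !slackE wi !lerD2l lerN2.
by apply: ler_sum => j _; apply: ler_wpM2l.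
Qed.

(** At each coordinate the minimum agrees with one of the two upper halves and lies below it
    everywhere, so [slack_le] bounds its slack from below by a nonnegative one. Which of the two
    serves may vary with the coordinate. *)
Lemma feasible_min (R : realType) (d : nat) (A : 'M[R]_d) (s D : 'cV[R]_d)
    (x y : 'cV[R]_(d + d)) :
    (forall i j, 0 <= A i j) -> feasible A s D x -> feasible A s D y ->
  let w := vec_min (usubmx x) (usubmx y) in
  feasible A s D (col_mx w (slack A s D w)).
Proof.
move=> A_ge0 /feasibleP[_ ux sx] /feasibleP[_ uy sy] w.
apply/feasibleP; rewrite col_mxKu col_mxKd; split=> // i.
  by rewrite [w i 0]mxE le_min ux uy.
have : w i 0 = usubmx x i 0 \/ w i 0 = usubmx y i 0.
  by rewrite [w i 0]mxE; case: leP; [left | right].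
case=> wi; [apply: le_trans (sx i) _ | apply: le_trans (sy i) _].
  exact: slack_le A_ge0 (@vec_min_le_l _ _ _ _) wi.
exact: slack_le A_ge0 (@vec_min_le_r _ _ _ _) wi.
Qed.

(** The minimum of the two upper halves is feasible and below that of [x], while optimality forbids
    a smaller objective value; hence it equals the upper half of [x]. *)
Lemma optimal_least (R : realType) (d : nat) (f : 'cV[R]_d -> R)
    (A : 'M[R]_d) (s D : 'cV[R]_d) (x y : 'cV[R]_(d + d)) :
    (forall i j, 0 <= A i j) -> vec_increasing f ->
    optimal f A s D x -> feasible A s D y ->
  vec_le (usubmx x) (usubmx y).
Proof.
move=> A_ge0 f_incr [x_feas x_min] y_feas.
have := x_min _ (feasible_min A_ge0 x_feas y_feas); rewrite col_mxKu.
move=> /(vec_increasing_le_eq f_incr (@vec_min_le_l _ _ _ _)) <-.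
exact: vec_min_le_r.
Qed.

Unset Implicit Arguments.
Set Strict Implicit.

Theorem theorem3 (R : realType) (d : nat) (E : rel 'I_d)
    (E_irrefl : irreflexive E)
    (H_irred : irreducible_mx (incidence_mx R E))
    (A : 'M[R]_d) (A_distr : distribution_mx (incidence_mx R E) A)
    (s D : 'cV[R]_d) (f1 f2 : 'cV[R]_d -> R)
    (f1_diff : forall x : 'cV[R]_d, differentiable f1 x)
    (f2_diff : forall x : 'cV[R]_d, differentiable f2 x)
    (f1_incr : vec_increasing f1) (f2_incr : vec_increasing f2)
    (x : 'cV[R]_(d + d)) (x_opt : optimal f1 A s D x) :
  unique (optimal f2 A s D) x.
Proof.
have A_ge0 := distribution_mx_ge0 A_distr.
have x_feas := x_opt.1.
have x_least y : feasible A s D y -> vec_le (usubmx x) (usubmx y).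
  exact: optimal_least A_ge0 f1_incr x_opt.
split=> [|y [y_feas y_min]].
  (* A least feasible upper half minimizes every increasing objective. *)
  by split=> // y /x_least; apply: vec_increasing_le.
(* Uniqueness: [y] lies above [x] in the upper half but has no larger [f2]-value. *)
have eq_xy : usubmx x = usubmx y.
  exact: vec_increasing_le_eq f2_incr (x_least _ y_feas) (y_min _ x_feas).
have [ex _ _] := (feasibleP _ _ _ _).1 x_feas.
have [ey _ _] := (feasibleP _ _ _ _).1 y_feas.
(* Equal upper halves force equal lower halves through [slack]. *)
by rewrite -[x]vsubmxK -[y]vsubmxK ex ey eq_xy.
Qed.
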